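(* Let $S=\mathbb{C}[x_0,\dots,x_n]$ with its standard grading, let $f\in S$ be homogeneous of degree $d\ge 1$ such that the hypersurface $V(f):f=0$ in $\mathbb{P}^n$ is smooth, and let $g\in S$ be homogeneous of degree $e\ge 1$. Let $m_2(f,g)\subset S$ be the ideal generated by all the $2\times 2$ minors of the Jacobian matrix of the mapping $(f,g):\mathbb{C}^{n+1}\to\mathbb{C}^2$, and define $$A(f,g)=S/\big((f)+m_2(f,g)\big),\qquad B(f,g)=S/\big((f)+(g)+m_2(f,g)\big).$$ Then the following conditions are equivalent: (i) $V(f,g)=V(f)\cap V(g)$ is a smooth complete intersection; (ii) $\dim_{\mathbb{C}} A(f,g)<\infty$; (iii) $\dim_{\mathbb{C}} B(f,g)<\infty$.
   Context: For a homogeneous polynomial $h\in S$ of positive degree, $V(h)$ denotes the hypersurface $h=0$ in the complex projective space $\mathbb{P}^n$. A point $p\in V(h)$ is a smooth point of $V(h)$ if the partial derivatives of $h$ with respect to $x_0,\dots,x_n$ do not all vanish at $p$ (smoothness with respect to the given equation $h$); $V(h)$ is smooth if all its points are smooth, equivalently if $\dim_{\mathbb{C}} S/J_h<\infty$, where $J_h$ is the ideal generated by the partial derivatives of $h$. One says that $V(f,g)=V(f)\cap V(g)$ is a smooth complete intersection if every point $p\in V(f,g)$ is a smooth point of both $V(f)$ and $V(g)$ and the corresponding tangent spaces $T_pV(f)$ and $T_pV(g)$ are distinct. The Jacobian matrix of $(f,g)$ is the $2\times(n+1)$ matrix whose rows are the partial derivatives of $f$ and of $g$ with respect to $x_0,\dots,x_n$.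 *)

(* Defs.v *)
From HB Require Import structures.
From mathcomp Require Import all_boot all_order all_algebra.
From mathcomp Require Import boolp classical_sets reals.
From mathcomp Require Import complex.
From mathcomp Require Import mpoly.

Set Implicit Arguments.
Unset Strict Implicit.
Unset Printing Implicit Defensive.

Import GRing.Theory.

Local Open Scope ring_scope.
Local Open Scope classical_set_scope.
Local Open Scope quotient_scope.

(* [idealr] of ring_quotient requires a proper ideal; here the unit ideal is
   allowed, since S / I may well be zero. *)
Record ideal (S : comNzRingType) := Ideal {
  ideal_set :> set S;
  ideal_zero : ideal_set 0;
  ideal_addr : forall x y, ideal_set x -> ideal_set y -> ideal_set (x + y);
  ideal_mulr : forall a x, ideal_set x -> ideal_set (a * x) }.

Section IdealOperations.
Variable S : comNzRingType.
Implicit Types (G : set S) (I J : ideal S).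

Definition ideal_gen_set G : set S :=
  [set x | forall I, G `<=` I -> ideal_set I x].

Definition ideal_gen G : ideal S.
Proof.
exists (ideal_gen_set G).
- by move=> I _; apply: ideal_zero.
- by move=> x y hx hy I GI; apply: ideal_addr; [apply: hx | apply: hy].
- by move=> a x hx I GI; apply: ideal_mulr; apply: hx.
Defined.

Definition ideal_sum I J : ideal S.
Proof.
exists [set x + y | x in I & y in J].
- by exists 0; [apply: ideal_zero | exists 0; [apply: ideal_zero | rewrite addr0]].
- move=> _ _ [x Ix [y Jy <-]] [x' Ix' [y' Jy' <-]].
  exists (x + x'); first exact: ideal_addr.
  by exists (y + y'); [apply: ideal_addr | rewrite addrACA].
- move=> a _ [x Ix [y Jy <-]].
  exists (a * x); first exact: ideal_mulr.
  by exists (a * y); [apply: ideal_mulr | rewrite mulrDr].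
Defined.

Definition ideal_mem I : {pred S} := fun x => `[< ideal_set I x >].

Lemma ideal_mem_zmod_closed I : zmod_closed (ideal_mem I).
Proof.
split=> [|x y /asboolP Ix /asboolP Iy]; apply/asboolP; first exact: ideal_zero.
by rewrite -mulN1r; apply: ideal_addr => //; apply: ideal_mulr.
Qed.

HB.instance Definition _ I :=
  GRing.isZmodClosed.Build S (ideal_mem I) (ideal_mem_zmod_closed I).

End IdealOperations.

Section QuotientSpace.
Variables (K : fieldType) (S : comAlgType K) (I : ideal S).

Definition quotient_space := {ideal_quot (ideal_mem I)}.

HB.instance Definition _ := GRing.Zmodule.on quotient_space.
HB.instance Definition _ := EqQuotient.on quotient_space.

Lemma quotient_piP (x y : S) :
  x = y %[mod quotient_space] <-> ideal_set I (x - y).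
Proof.
split=> [/eqP|Ixy]; first by rewrite -Quotient.idealrBE => /asboolP.
by apply/eqP; rewrite -Quotient.idealrBE; apply/asboolP.
Qed.

Definition quotient_scale (c : K) (x : quotient_space) : quotient_space :=
  \pi_quotient_space (c *: repr x).

Lemma quotient_scale_pi c (x : S) :
  quotient_scale c (\pi_quotient_space x)
    = \pi_quotient_space (c *: x).
Proof.
apply/quotient_piP; rewrite -scalerBr -mulr_algl.
by apply: ideal_mulr; apply/quotient_piP; rewrite reprK.
Qed.

Lemma quotient_scaleA a b (x : quotient_space) :
  quotient_scale a (quotient_scale b x) = quotient_scale (a * b) x.
Proof. by elim/quotW: x => x; rewrite (quotient_scale_pi b) !quotient_scale_pi scalerA. Qed.

Lemma quotient_scale1 : left_id 1 quotient_scale.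
Proof. by elim/quotW => x; rewrite quotient_scale_pi scale1r. Qed.

Lemma quotient_scaleDr : right_distributive quotient_scale +%R.
Proof.
move=> a; elim/quotW => x; elim/quotW => y.
by rewrite -raddfD !quotient_scale_pi scalerDr raddfD.
Qed.

Lemma quotient_scaleDl (x : quotient_space) :
  {morph quotient_scale^~ x : a b / a + b}.
Proof.
by move=> a b; elim/quotW: x => x; rewrite !quotient_scale_pi scalerDl raddfD.
Qed.

HB.instance Definition _ := GRing.Zmodule_isLmodule.Build K quotient_space
  quotient_scaleA quotient_scale1 quotient_scaleDr quotient_scaleDl.

End QuotientSpace.

Definition finite_dimensional (K : fieldType) (V : lmodType K) : Prop :=
  exists (k : nat) (b : 'I_k -> V),
    forall v : V, exists c : 'I_k -> K, v = \sum_(i < k) c i *: b i.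

Section Hypersurfaces.
Variables (K : fieldType) (n : nat).
Local Notation S := {mpoly K[n.+1]}.
Implicit Types f g h : S.

Definition proj_space := {L : {vspace 'rV[K]_n.+1} | \dim L == 1%N}.
Implicit Type p : proj_space.

(* For homogeneous h, this does not depend on the choice of the homogeneous
   coordinates v of p. *)
Definition vanishes_at h p : Prop :=
  forall v : 'rV[K]_n.+1, v \in sval p -> v != 0 -> h.@[v ord0] = 0.

Definition hypersurface h : set proj_space := [set p | vanishes_at h p].

Definition smooth_point h : set proj_space :=
  [set p | hypersurface h p /\ ~ (forall i, vanishes_at h^`M(i) p)].

Definition smooth_hypersurface h : Prop := hypersurface h `<=` smooth_point h.

(* The kernel of the differential of h at p, i.e. the affine cone over the
   projective tangent space of V(h) at p; the tangent space as a subspace of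
   T_p P^n = K^(n+1) / p is its image, and it determines it since by Euler's
   formula the kernel contains the line p. *)
Definition tangent_space h p : set 'rV[K]_n.+1 :=
  [set w | vanishes_at (\sum_i w ord0 i *: h^`M(i)) p].

Definition smooth_complete_intersection f g : Prop :=
  forall p, (hypersurface f `&` hypersurface g) p ->
    [/\ smooth_point f p, smooth_point g p
      & tangent_space f p <> tangent_space g p].

Definition jacobian f g : 'M[S]_(2, n.+1) :=
  \matrix_(i, j) (if i == ord0 then f else g)^`M(j).

Definition minors2 (M : 'M[S]_(2, n.+1)) : set S :=
  [set \det (colsub s M) | s in [set s : 'I_2 -> 'I_n.+1 | s ord0 < s ord_max]%N].

Definition m2 f g : ideal S := ideal_gen (minors2 (jacobian f g)).

Definition algA f g : lmodType K :=
  quotient_space (ideal_sum (ideal_gen [set f]) (m2 f g)).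

Definition algB f g : lmodType K :=
  quotient_space
    (ideal_sum (ideal_sum (ideal_gen [set f]) (ideal_gen [set g])) (m2 f g)).

End Hypersurfaces.

(* Main.v *)
Require Import Defs.
From mathcomp Require Import all_boot all_order all_algebra.
From mathcomp Require Import boolp classical_sets reals.
From mathcomp Require Import complex mpoly.
From mathcomp Require Import cardinality finmap.

(** The theorem is an application of the projective Nullstellensatz: for an
ideal [I] whose zero set in affine space is a cone, [S / I] is finite
dimensional exactly when the origin is the only possible zero of [I]
([finite_dimensional_cone]).  So (ii) and (iii) say that certain systems of
equations have no solution [v != 0]: for [A(f,g)] the system is [f(v) = 0]
together with the proportionality of the gradients of [f] and [g] at [v]
([jacobian_degenerate]), and for [B(f,g)] one adds [g(v) = 0].

(i) => (ii).  Let [v != 0] solve the first system.  Since [V(f)] is smooth,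
the gradient of [f] at [v] is nonzero, hence that of [g] is [c] times it.
Euler's formula gives [e g(v) = c d f(v) = 0], so [v] represents a point of
[V(f,g)], at which the gradients are proportional.  There either [c = 0] and
[V(g)] is singular, or [c != 0] and the tangent spaces coincide; both
contradict (i).  (ii) => (iii): the second system is stronger than the first.
(iii) => (i): at a point of [V(f,g)] the gradients are not proportional, so
neither vanishes and their kernels differ.

The Nullstellensatz is proved here from the uncountability of the complex
numbers.  If no power of [h] lies in [I], choose an ideal [m] containing [I]
and maximal among those that contain no power of [h]; it is prime, and it
generates a maximal ideal of [S[1/h]].  Each [t] in [S] is congruent modulo
[m] to a constant ([residue_field_trivial]): otherwise all the [t - c] would
be invertible in the residue field, and these uncountably many inverses would
be linearly independent in a space of countable dimension.  The
constants attached to the variables are the coordinates of a zero of [I] at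
which [h] does not vanish. *)

Set Implicit Arguments.
Unset Strict Implicit.
Unset Printing Implicit Defensive.

Import Order.TTheory GRing.Theory Num.Theory.
Local Open Scope ring_scope.

(** * Ideals maximal among those avoiding the powers of an element *)

Section IdealLemmas.
Local Open Scope classical_set_scope.
Variable S : comNzRingType.
Implicit Types (I J m : ideal S) (x y h : S).

Lemma ideal_opp I x : ideal_set I x -> ideal_set I (- x).
Proof. by rewrite -mulN1r; apply: ideal_mulr. Qed.

Lemma ideal_sub I x y : ideal_set I x -> ideal_set I y -> ideal_set I (x - y).
Proof. by move=> Ix /ideal_opp; apply: ideal_addr. Qed.

Lemma ideal_bigsum I (T : Type) (r : seq T) (P : pred T) (F : T -> S) :
  (forall i, P i -> ideal_set I (F i)) -> ideal_set I (\sum_(i <- r | P i) F i).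
Proof.
by move=> IF; elim/big_ind: _ => //; [apply: ideal_zero | apply: ideal_addr].
Qed.

Lemma ideal_congr I x y : ideal_set I (x - y) -> ideal_set I x -> ideal_set I y.
Proof. by move=> Ixy Ix; rewrite -(subKr x y); apply: ideal_sub. Qed.

Lemma sub_ideal_gen (G : set S) : G `<=` ideal_gen G.
Proof. by move=> x Gx I; apply. Qed.

Lemma sub_ideal_suml I J : I `<=` ideal_sum I J.
Proof.
by move=> x Ix; exists x => //; exists 0; [apply: ideal_zero | rewrite addr0].
Qed.

Lemma sub_ideal_sumr I J : J `<=` ideal_sum I J.
Proof.
by move=> x Jx; exists 0; [apply: ideal_zero | exists x; rewrite ?add0r].
Qed.

Definition principal x : ideal S.
Proof.
exists [set y | exists a, y = a * x].
- by exists 0; rewrite mul0r.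
- by move=> _ _ [a ->] [b ->]; exists (a + b); rewrite mulrDl.
- by move=> a _ [b ->]; exists (a * b); rewrite mulrA.
Defined.

(** The ideals whose extension to [S[1/h]] is proper. *)
Definition avoids h I := forall k, ~ ideal_set I (h ^+ k).

(** Maximality is expressed by what it is used for: an element outside [m] is
invertible modulo [m] in [S[1/h]], with inverse [a / h ^+ k]. *)
Definition maximal_avoiding h m := avoids h m /\
  forall x, ~ ideal_set m x -> exists a k, ideal_set m (a * x - h ^+ k).

(** Zorn's lemma applies because the union of a nonempty chain of ideals is an
ideal.  If [x] is not in the maximal ideal [m], then [m + (x)] contains some
[h ^+ k]. *)
Lemma maximal_avoiding_ideal I h : avoids h I ->
  exists2 m : ideal S, I `<=` m & maximal_avoiding h m.
Proof.
move=> Ih.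
pose good A := exists J, [/\ I `<=` J, avoids h J & A = J :> set S].
(* [set0] is admitted only because it is the union of the empty chain. *)
pose P A := A = set0 \/ good A.
have [F FP Ftot|A [PA Amax]] := @Zorn_bigcup S P.
  have [Fgood|/forallNP Fbad] := pselect (exists A, F A /\ good A); last first.
    left; rewrite -subset0 => x [A FA Ax].
    by case: (FP _ FA) => [A0|/(conj FA)/Fbad//]; rewrite A0 in Ax.
  right.
  have memF A x : F A -> A x -> good A.
    by move=> FA Ax; case: (FP _ FA) => // A0; rewrite A0 in Ax.
  have [B [FB [JB [IJB _ eB]]]] := Fgood.
  have U0 : (\bigcup_(X in F) X) 0.
    by exists B; rewrite // eB; apply: ideal_zero.
  have UD x y : (\bigcup_(X in F) X) x -> (\bigcup_(X in F) X) y ->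
      (\bigcup_(X in F) X) (x + y).
    move=> [A FA Ax] [C FC Cy].
    have [J [_ _ eA]] := memF _ _ FA Ax; have [L [_ _ eC]] := memF _ _ FC Cy.
    have [AC|CA] := Ftot _ _ FA FC.
      exists C => //; rewrite eC; apply: ideal_addr; rewrite -eC //.
      exact: AC.
    exists A => //; rewrite eA; apply: ideal_addr; rewrite -eA //.
    exact: CA.
  have UM a x : (\bigcup_(X in F) X) x -> (\bigcup_(X in F) X) (a * x).
    move=> [A FA Ax]; have [J [_ _ eA]] := memF _ _ FA Ax.
    by exists A => //; rewrite eA; apply: ideal_mulr; rewrite -eA.
  exists (Ideal U0 UD UM); split=> //= [x Ix | k [A FA Ak]].
    by exists B => //; rewrite eB; apply: IJB.
  have [J [_ + eA]] := memF _ _ FA Ak; rewrite eA in Ak.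
  by move/(_ k).
have [A0|[m [Im mh eA]]] := PA.
  case: (Amax I); last by right; exists I; split.
  rewrite A0; split; first exact: sub0set.
  by move/(_ 0 (ideal_zero I)).
exists m => //; split=> // x mx; apply: contrapT => nx.
case: (Amax (ideal_sum m (principal x))).
  rewrite eA; split; first exact: sub_ideal_suml.
  move/(_ x); apply: contra_not mx; apply; apply: sub_ideal_sumr.
  by exists 1; rewrite mul1r.
right; exists (ideal_sum m (principal x)); split=> //.
  by apply: subset_trans Im _; apply: sub_ideal_suml.
move=> k [y my [_ [a ->] e]]; apply: nx; exists a, k.
by rewrite -e addrC opprD addrNK; apply: ideal_opp.
Qed.

Lemma maximal_avoiding_prime m h : maximal_avoiding h m ->
  forall x y, ideal_set m (x * y) -> ideal_set m x \/ ideal_set m y.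
Proof.
move=> [mh mmax] x y mxy; apply: contrapT.
move=> /not_orP[/mmax[a [k ak]] /mmax[b [l bl]]].
apply: (mh (k + l)%N); rewrite exprD.
apply: (ideal_congr (x := (a * b) * (x * y))); last exact: ideal_mulr.
rewrite mulrACA (_ : _ - _ =
  (b * y) * (a * x - h ^+ k) + h ^+ k * (b * y - h ^+ l)).
  by apply: ideal_addr; apply: ideal_mulr.
by rewrite !mulrBr (mulrC (b * y)) (mulrC (b * y)) addrA addrNK.
Qed.

End IdealLemmas.

(** * Common zeros of an ideal of polynomials *)

Section Zeros.
Local Open Scope classical_set_scope.
Variables (K : comNzRingType) (n : nat).
Local Notation S := {mpoly K[n]}.
Implicit Types (I J : ideal S) (v : 'I_n -> K).

Definition common_zero I v := forall p, ideal_set I p -> p.@[v] = 0.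

Lemma common_zero_gen (G : set S) v :
  common_zero (ideal_gen G) v <-> forall p, G p -> p.@[v] = 0.
Proof.
split=> [Gv p Gp|Gv p]; first exact/Gv/sub_ideal_gen.
(* The polynomials vanishing at [v] form an ideal. *)
pose E := [set q : S | q.@[v] = 0].
have E0 : E 0 by apply: meval0.
have ED p1 p2 : E p1 -> E p2 -> E (p1 + p2).
  by rewrite /E /= mevalD => -> ->; rewrite addr0.
have EM a p1 : E p1 -> E (a * p1) by rewrite /E /= mevalM => ->; rewrite mulr0.
by move/(_ (Ideal E0 ED EM)); apply.
Qed.

Lemma common_zero_sum I J v :
  common_zero (ideal_sum I J) v <-> common_zero I v /\ common_zero J v.
Proof.
split=> [IJv|[Iv Jv] _ [p Ip [q Jq <-]]].
  by split=> p ?; apply: IJv; [apply: sub_ideal_suml | apply: sub_ideal_sumr].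
by rewrite mevalD Iv ?Jv ?addr0.
Qed.
End Zeros.

(** * Linear dependence *)

Lemma wide_system_solution (K : fieldType) D k (A : 'M[K]_(D, k)) : (k < D)%N ->
  exists a : 'I_D -> K,
    (exists i, a i != 0) /\ forall j, \sum_i a i * A i j = 0.
Proof.
move=> kD; have /rowV0Pn[v vA v0] : kermx A != 0.
  rewrite -mxrank_eq0 mxrank_ker -lt0n subn_gt0.
  exact: leq_ltn_trans (rank_leq_col A) kD.
exists (v ord0); split=> [|j]; first exact/rV0Pn.
by move/sub_kermxP/matrixP/(_ ord0 j): vA; rewrite !mxE.
Qed.

Lemma mpoly_dependent (K : fieldType) n k D (u : 'I_D -> {mpoly K[n]}) :
    (forall i, msize (u i) <= k)%N -> (#|{: 'X_{1..n < k}}| < D)%N ->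
  exists a : 'I_D -> K, (exists i, a i != 0) /\ \sum_i a i *: u i = 0.
Proof.
move=> uk; pose T : finType := 'X_{1..n < k}.
pose A := \matrix_(i < D, j < #|T|) (u i)@_(bmnm (enum_val j)).
move=> /(wide_system_solution A)[a [a0 aA]].
exists a; split=> //; apply/mpolyP=> m; rewrite mcoeff0 raddf_sum /=.
have [mk|mk] := ltnP (mdeg m) k; last first.
  apply: big1 => i _; rewrite mcoeffZ memN_msupp_eq0 ?mulr0 //.
  by apply: contraL mk => /msize_mdeg_lt/leq_trans/(_ (uk i)); rewrite -ltnNge.
rewrite -[RHS](aA (enum_rank (BMultinom mk : T))); apply: eq_bigr => i _.
by rewrite mcoeffZ mxE enum_rankK.
Qed.

Lemma spanning_dependent (K : fieldType) (V : lmodType K) :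
    finite_dimensional V ->
  exists D, forall w : 'I_D -> V,
    exists a : 'I_D -> K, (exists i, a i != 0) /\ \sum_i a i *: w i = 0.
Proof.
move=> [k [b bP]]; exists k.+1 => w.
have /choice[C CP] : forall i, exists c, w i = \sum_(l < k) c l *: b l.
  by move=> i; apply: bP.
have [a [a0 aC]] := wide_system_solution (\matrix_(i, l) C i l) (ltnSn k).
exists a; split=> //; under eq_bigr do rewrite CP scaler_sumr.
rewrite exchange_big /= big1 // => l _; under eq_bigr do rewrite scalerA.
rewrite -scaler_suml -[RHS](scale0r (b l)) -[in RHS](aC l).
by under [in RHS]eq_bigr do rewrite mxE.
Qed.

(** * Nullstellensatz over an uncountable algebraically closed field *)

Section Uncountable.
Local Open Scope classical_set_scope.

(** Some fiber is infinite, since countably many finite fibers would make [T]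
countable.  One [k] serves for all sizes [D]: the size needed later depends
on [k]. *)
Lemma uncountable_fiber (T : choiceType) (N : T -> nat) :
    ~ countable [set: T] ->
  exists k, forall D, exists c : 'I_D -> T,
    injective c /\ forall i, N (c i) = k.
Proof.
move=> Tunc; apply: contrapT => /forallNP small; apply: Tunc.
have -> : [set: T] = \bigcup_k [set x | N x = k].
  by apply/seteqP; split=> // x _; exists (N x).
apply: bigcup_countable => // k _; apply: finite_set_countable.
apply: contrapT => inf; apply: (small k) => D.
have [B BN DB] := infinite_set_fset D inf.
have [x0 _] := infinite_setN0 inf.
exists (fun i : 'I_D => nth x0 (enum_fset B) i); split=> [i j /eqP|i].
  by rewrite nth_uniq ?fset_uniq ?(leq_trans _ DB) // => /eqP/val_inj.
by apply: BN; rewrite /= mem_nth // (leq_trans _ DB).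
Qed.

End Uncountable.

Section Nullstellensatz.
Local Open Scope classical_set_scope.
Variables (n : nat).

(** The value at [c i0] is [a i0] times a product of nonzero factors. *)
Lemma interpolation_neq0 (K : fieldType) D (a c : 'I_D -> K) i0 :
    injective c -> a i0 != 0 ->
  \sum_i a i *: \prod_(j | j != i) ('X - (c j)%:P) != 0.
Proof.
move=> cinj a0; apply: contra_neq a0 => /(congr1 (fun p => p.[c i0])).
rewrite horner0 horner_sum (bigD1 i0) //= [X in _ + X]big1 ?addr0.
  rewrite hornerZ => /eqP; rewrite mulf_eq0 => /orP[/eqP //|].
  rewrite horner_prod prodf_seq_eq0 => /hasP[j _ /andP[ji]].
  by rewrite !hornerE subr_eq0 => /eqP/cinj e; rewrite e eqxx in ji.
move=> i ii0; rewrite hornerZ horner_prod (bigD1 i0) 1?eq_sym //=.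
by rewrite hornerXsubC subrr mul0r mulr0.
Qed.

Variable K : closedFieldType.
Hypothesis K_uncountable : ~ countable [set: K].
Local Notation S := {mpoly K[n]}.

(** If [t - c] were outside [m] for all [c], it would have an inverse
[u_c / h ^+ k_c] modulo [m].  For infinitely many [c] the exponent [k_c] and
the size of [u_c] are the same, so some of these [u_c] satisfy a linear
relation [\sum_i a_i u_(c_i) = 0].  Multiplied by [\prod_j (t - c_j)] it says
that [h ^+ k * q(t)] lies in [m], where [q] is the nonzero polynomial of
[interpolation_neq0].  As [m] is prime and [q] splits, [m] contains some
[t - z]. *)
Lemma residue_field_trivial (m : ideal S) h : maximal_avoiding h m ->
  forall t, exists c : K, ideal_set m (t - c%:A).
Proof.
move=> mhmax t; apply: contrapT => /forallNP noc.
have mprime := maximal_avoiding_prime mhmax; have [mh mmax] := mhmax.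
have /choice[u uP] (c : K) : exists u : S * nat,
    ideal_set m (u.1 * (t - c%:A) - h ^+ u.2).
  by have [a [k ak]] := mmax _ (noc c); exists (a, k).
pose size_exponent c := choice.pickle (msize (u c).1, (u c).2).
have [N Nc] := uncountable_fiber size_exponent K_uncountable.
(* A first element of the fiber names the common size and exponent. *)
have [c0 [_ /(_ ord0) c0N]] := Nc 1%N; rewrite -{N}c0N /size_exponent in Nc.
set s := msize (u (c0 _)).1 in Nc; set k := (u (c0 _)).2 in Nc.
have [c [cinj cN]] := Nc #|{: 'X_{1..n < s}}|.+1.
have {}cN i : (u (c i)).2 = k /\ msize (u (c i)).1 = s.
  by have /(pcan_inj choice.pickleK)[] := cN i.
have [i|//|a [[i0 ai0] adep]] :=
    @mpoly_dependent K n s _ (fun i => (u (c i)).1).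
  by have [_ ->] := cN i.
pose q := \sum_i a i *: \prod_(j | j != i) ('X - (c j)%:P).
have q0 : q != 0 by apply: interpolation_neq0 ai0.
have XE z : horner_alg t ('X - z%:P) = t - z%:A.
  by rewrite rmorphB /= horner_algX horner_algC.
have mqt : ideal_set m (horner_alg t q).
  have : ideal_set m (h ^+ k * horner_alg t q); last by case/mprime => // /mh.
  pose P := \prod_j (t - (c j)%:A).
  apply: (ideal_congr (x := (\sum_i a i *: (u (c i)).1) * P)); last first.
    by rewrite adep mul0r; apply: ideal_zero.
  rewrite linear_sum mulr_suml mulr_sumr -sumrB; apply: ideal_bigsum => i _.
  rewrite [X in _ ^+ _ * X]linearZ /= -scalerAl -[X in X - _]mulr_algl.
  rewrite (mulrCA (h ^+ k)) -mulrBr; apply: ideal_mulr.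
  rewrite /P (bigD1 i) //= mulrA rmorph_prod.
  under [X in _ - _ * X]eq_bigr do rewrite /= XE.
  rewrite -mulrBl mulrC; apply: ideal_mulr.
  by have [<- _] := cN i; apply: uP.
have [r qE] := closed_field_poly_normal q.
have {mqt} : ideal_set m (\prod_(z <- r) (t - z%:A)).
  move: mqt; rewrite qE linearZ /= rmorph_prod.
  move=> /(ideal_mulr (lead_coef q)^-1%:A); rewrite mulrA -scalerAl mul1r.
  rewrite scalerA mulVf ?lead_coef_eq0 // scale1r mul1r.
  by under eq_bigr do rewrite /= XE.
elim: r {qE} => [|z r IHr]; first by rewrite big_nil; apply: (mh 0%N).
by rewrite big_cons => /mprime[/noc|].
Qed.

(** The constants congruent to the variables modulo [m] form a point [v] such
that [p] is congruent to [p(v)] for all [p]. *)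
Theorem nullstellensatz (I : ideal S) h :
    (forall v : 'I_n -> K, common_zero I v -> h.@[v] = 0) ->
  exists k, ideal_set I (h ^+ k).
Proof.
move=> hV; apply: contrapT => /forallNP /maximal_avoiding_ideal[m Im mhmax].
have [mh _] := mhmax; have res := residue_field_trivial mhmax.
have [v vP] := choice (fun i => res 'X_i).
have mvM p q :
    ideal_set m (p - (p.@[v])%:A) -> ideal_set m (q - (q.@[v])%:A) ->
    ideal_set m (p * q - ((p * q).@[v])%:A).
  move=> mp mq; rewrite mevalM.
  rewrite (_ : _ - _ = p * (q - (q.@[v])%:A) + (q.@[v])%:A * (p - (p.@[v])%:A)).
    by apply: ideal_addr; apply: ideal_mulr.
  rewrite -scalerA -[X in _ - X]mulr_algl !mulrBr (mulrC p (_%:A)) addrA addrNK.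
  by rewrite (mulrC (q.@[v])%:A (_%:A)).
have mv p : ideal_set m (p - (p.@[v])%:A).
  elim/mpolyind: p => [|c M p _ _ IHp].
    by rewrite meval0 scale0r subrr; apply: ideal_zero.
  rewrite mevalD scalerDl opprD addrACA; apply: ideal_addr IHp.
  rewrite mevalZ -scalerA -scalerBr -[X in ideal_set _ X]mulr_algl.
  apply: ideal_mulr.
  rewrite mpolyXE_id.
  have m1 : ideal_set m (1 - (1.@[v])%:A).
    by rewrite meval1 scale1r subrr; apply: ideal_zero.
  elim/big_ind: _ => // i _; elim: (M i) => [//|k IHk].
  by rewrite exprS; apply: mvM; rewrite // mevalXU.
have scalar_m c : c != 0 -> ~ ideal_set m c%:A.
  move=> c0 /(ideal_mulr c^-1%:A).
  rewrite -scalerAl mul1r scalerA mulVf // scale1r.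
  exact: (mh 0%N).
have hv : h.@[v] = 0.
  apply: hV => p /Im mp; apply: contrapT => /eqP/scalar_m; apply.
  exact: ideal_congr (mv p) mp.
by apply: (mh 1%N); rewrite expr1; move: (mv h); rewrite hv scale0r subr0.
Qed.
End Nullstellensatz.

(** * Uncountability of the complex numbers *)

Section RealUncountable.
Local Open Scope classical_set_scope.
Variable R : realType.

Lemma nested_intervals (a b : nat -> R) :
    (forall n, a n <= a n.+1) -> (forall n, b n.+1 <= b n) ->
    (forall n, a n <= b n) ->
  exists c, forall n, a n <= c <= b n.
Proof.
move=> a_inc b_dec ab.
have a_mon : {homo a : m n / (m <= n)%N >-> m <= n}.
  exact: (homo_leq lexx le_trans).
have b_mon : {homo b : m n / (m <= n)%N >-> n <= m}.
  by apply: (homo_leq (r := fun x y => y <= x)) => // y x z xy /le_trans; apply.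
have amb m n : a m <= b n.
  apply: (@le_trans _ _ (a (maxn m n))); first by rewrite a_mon // leq_maxl.
  by apply: le_trans (ab _) _; rewrite b_mon // leq_maxr.
exists (sup (range a)) => n; apply/andP; split.
  apply: ub_le_sup; last by exists n.
  by exists (b 0%N) => _ [m _ <-].
by apply: ge_sup; [exists (a 0%N), 0%N | move=> _ [m _ <-]].
Qed.

(** Cantor's nested intervals: given an injection [f] into the naturals, the
interval of rank [k.+1] is chosen inside that of rank [k] so as to miss [x k],
the only real that [f] can map to [k]; so a real [c] in all the intervals is
missed by the one of rank [(f c).+1]. *)
Lemma real_uncountable : ~ countable [set: R].
Proof.
move=> /countable_injP[f finjT].
have finj : injective f by move=> r s; apply: finjT; apply: in_setT.
pose x k := xget 0 [set r | f r = k].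
have xK r : x (f r) = r.
  rewrite /x; case: xgetP => [y ey fy|/(_ r)//]; first exact: finj.
  by move/(_ erefl).
pose mid (I : R * R) := (I.1 + I.2) / 2.
(* In the second case [x k] may be the midpoint itself, so the new upper end
   has to lie strictly below it. *)
pose next k (I : R * R) :=
  if x k < mid I then (mid I, I.2) else (I.1, mid (I.1, mid I)).
pose J := fix J k := if k is k'.+1 then next k' (J k') else (0, 1) : R * R.
have J_lt k : (J k).1 < (J k).2.
  elim: k => [|k IHk] /=; first exact: ltr01.
  by rewrite /next; case: ifP => _ /=; rewrite /mid /=; rewrite ?midf_lt.
have mid_in (a b : R) : a < b -> a < (a + b) / 2 < b.
  by move=> ab; rewrite !midf_lt.
have [k|k|k|c cJ] := @nested_intervals (fst \o J) (snd \o J).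
- rewrite /= /next; case: ifP => _ //=; rewrite /mid.
  by have /andP[/ltW] := mid_in _ _ (J_lt k).
- rewrite /= /next; case: ifP => _ //=; rewrite /mid /=.
  have /andP[l r] := mid_in _ _ (J_lt k); have /andP[_ r'] := mid_in _ _ l.
  by rewrite ltW // (lt_trans r').
- exact/ltW/J_lt.
have /andP[] := cJ (f c).+1; rewrite /= /next xK.
case: ltP => /= [cm mc _|mc _]; first by rewrite leNgt cm in mc.
apply/negP; rewrite -ltNge; apply: lt_le_trans mc.
by have /andP[/mid_in/andP[]] := mid_in _ _ (J_lt (f c)).
Qed.

Lemma complex_uncountable : ~ countable [set: R[i]].
Proof.
move=> /countable_injP[f finj]; apply: real_uncountable.
apply/countable_injP; exists (fun r => f (r%:C)%C) => r s _ _ /finj.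
by case/(_ (in_setT _) (in_setT _)).
Qed.

End RealUncountable.

(** * Finite-dimensional quotients and cones *)

Section FiniteDimension.
Local Open Scope classical_set_scope.

Variables (K : fieldType) (n : nat).
Local Notation S := {mpoly K[n]}.

(** A monomial of degree larger than [\sum_i k_i] is divisible by some
['X_i ^+ k_i], so the monomials of degree at most [\sum_i k_i] span the
quotient. *)
Lemma quotient_finite_dimensional (I : ideal S) :
    (forall i, exists k, ideal_set I ('X_i ^+ k)) ->
  finite_dimensional (quotient_space I).
Proof.
move=> /choice[k kI]; pose N := (\sum_i k i)%N.
pose T : finType := 'X_{1..n < N.+1}.
pose X (m : T) : S := 'X_[bmnm m].
exists #|T|, (fun i => \pi_(quotient_space I)%qT (X (enum_val i))) => v.
elim/quotW: v => p; exists (fun i => p@_(bmnm (enum_val i))).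
have lowI m : (N < mdeg m)%N -> ideal_set I 'X_[m].
  move=> Nm; have [i kim] : exists i, (k i <= m i)%N.
    apply: contrapT => /forallNP mk; move: Nm; apply/negP.
    rewrite -leqNgt mdegE.
    by apply: leq_sum => i _; rewrite ltnW // ltnNge; apply/negP/mk.
  have Um : (U_(i) *+ k i <= m)%MM.
    apply/mnm_lepP => j; rewrite mulmnE mnm1E.
    by case: eqP => [<-|]; rewrite ?mul1n ?mul0n.
  rewrite -(submK Um).
  by rewrite mpolyXD -mpolyXn; apply: ideal_mulr.
have -> : \sum_(i < #|T|) p@_(bmnm (enum_val i)) *:
      \pi_(quotient_space I)%qT (X (enum_val i)) =
    \pi_(quotient_space I)%qT (\sum_(m : T) p@_(bmnm m) *: X m).
  rewrite (big_enum_val (fun m : T => p@_(bmnm m) *: X m)) raddf_sum /=.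
  by apply: eq_bigr => i _; apply: quotient_scale_pi.
apply/quotient_piP; set q := \sum_(m : T) _.
rewrite [p - q]mpolyE big_seq; apply: ideal_bigsum => m.
rewrite mcoeff_msupp mcoeffB => pqm.
rewrite -mulr_algl; apply: ideal_mulr; apply: lowI; rewrite ltnNge.
apply: contraNN pqm => mN.
by rewrite (mcoeff_mpoly (fun m => p@_m)) ?subrr.
Qed.

End FiniteDimension.

Section Cone.
Local Open Scope classical_set_scope.
Variables (K : closedFieldType) (n : nat).
Hypothesis K_uncountable : ~ countable [set: K].
Local Notation S := {mpoly K[n]}.

(** If [I] has a zero [v] with [v_i != 0], then [I] vanishes on the line through
[v]; finite dimension gives a linear relation modulo [I] between powers of
['X_i], hence a nonzero polynomial in one variable with every scalar as a
root.  Conversely, if [I]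
has no zero but the origin, every variable vanishes on the zeros of [I], so
a power of it lies in [I] by the Nullstellensatz. *)
Lemma finite_dimensional_cone (I : ideal S) :
    (forall (v : 'I_n -> K) c,
      common_zero I v -> common_zero I (fun i => c * v i)) ->
  finite_dimensional (quotient_space I) <->
  forall v, common_zero I v -> forall i, v i = 0.
Proof.
move=> cone; split=> [/spanning_dependent[D dep] v Iv i|Iv].
  apply: contrapT => /eqP vi0.
  have [a [[j0 aj0] adep]] :=
    dep (fun j => \pi_(quotient_space I)%qT ('X_i ^+ j)).
  have {adep} : ideal_set I (\sum_j a j *: 'X_i ^+ j).
    rewrite -[X in ideal_set I X]subr0; apply/quotient_piP.
    rewrite raddf_sum raddf0 -[RHS]adep.
    by apply: eq_bigr => j _; apply/esym/quotient_scale_pi.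
  move=> Ia; pose q := \poly_(j < D) (if insub j is Some j' then a j' else 0).
  have qj (j : 'I_D) : q`_j = a j.
    by rewrite coef_poly ltn_ord valK.
  have q0 : q != 0.
    by apply: contra_neq aj0 => q0; rewrite -qj q0 coef0.
  have /closed_nonrootP[x] := q0; apply/negP; rewrite negbK.
  (* the point of the line whose coordinate of index [i] is [x] *)
  have := cone v (x / v i) Iv _ Ia.
  rewrite raddf_sum /= => aE; apply/rootP; rewrite horner_poly -[RHS]aE.
  apply: eq_bigr => j _; rewrite valK mevalZ rmorphXn /= mevalXU.
  by rewrite divfK.
apply: quotient_finite_dimensional => i; apply: nullstellensatz => // v /Iv v0.
by rewrite mevalXU.
Qed.
End Cone.

(** * Homogeneous polynomials *)

Section Homogeneous.
Variables (K : comNzRingType) (n : nat).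
Local Notation S := {mpoly K[n]}.
Implicit Types (f : S) (v : 'I_n -> K).

Lemma meval_homog d f v c : f \is d.-homog ->
  f.@[fun i => c * v i] = c ^+ d * f.@[v].
Proof.
move=> /dhomogP fd; rewrite !mevalE mulr_sumr; apply: eq_big_seq => m /fd <-.
rewrite mulrCA /= mdegE; congr (_ * _).
by under eq_bigr do rewrite exprMn; rewrite big_split prodrXr.
Qed.

Lemma mderiv_homog d f i : f \is d.-homog -> f^`M(i) \is d.-1.-homog.
Proof.
move=> fd; apply/dhomogP => m; rewrite mcoeff_msupp mcoeff_deriv => fm.
have /(dhomogP _ _ _ fd) : (m + U_(i))%MM \in msupp f.
  by rewrite mcoeff_msupp; apply: contraNneq fm => ->; rewrite mul0rn.
by rewrite /= mdegD mdeg1 => <-; rewrite addn1.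
Qed.

Lemma euler d f : f \is d.-homog -> \sum_i 'X_i * f^`M(i) = f *+ d.
Proof.
move=> /dhomogP fd; rewrite {2}[f]mpolyE -sumrMnl.
under eq_bigr do rewrite {1}[f]mpolyE raddf_sum mulr_sumr.
rewrite exchange_big /=; apply: eq_big_seq => m /fd <-.
rewrite /= mdegE -sumrMnr; apply: eq_bigr => i _.
rewrite mderivZ mderivX -!scalerAr scaler_nat scalerMnr; congr (_ *: _).
have [->|mi] := eqVneq (m i) 0%N; first by rewrite !mulr0n.
rewrite -mpolyXD; congr ('X_[_] *+ _).
by rewrite addmC submK // lep1mP.
Qed.

Lemma euler_eval d f v : f \is d.-homog ->
  \sum_i v i * (f^`M(i)).@[v] = f.@[v] *+ d.
Proof.
move=> /euler/(congr1 (meval v)); rewrite raddf_sum /= mevalMn => <-.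
by apply: eq_bigr => i _; rewrite mevalM mevalXU.
Qed.
End Homogeneous.

(** * Points, tangent spaces and minors *)

Lemma det_mx2 (T : comNzRingType) (A : 'M[T]_2) :
  \det A = A ord0 ord0 * A ord_max ord_max - A ord0 ord_max * A ord_max ord0.
Proof.
rewrite (expand_det_row _ ord0) !big_ord_recl big_ord0 addr0 /cofactor.
rewrite !det_mx11 !mxE expr0 expr1 mul1r mulN1r mulrN.
by congr (_ * A _ _ - A _ _ * A _ _); apply: val_inj.
Qed.

(** If every vector orthogonal to [a] is orthogonal to [b], so is
[a_j e_i - a_i e_j]. *)
Lemma orthogonal_sub_degenerate (K : comNzRingType) n (a b : 'I_n -> K) :
    (forall w : 'rV[K]_n,
      \sum_k w ord0 k * a k = 0 -> \sum_k w ord0 k * b k = 0) ->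
  forall i j, a i * b j = a j * b i.
Proof.
move=> ab i j; pose w : 'rV[K]_n := a j *: delta_mx 0 i - a i *: delta_mx 0 j.
have deltaE k (c : 'I_n -> K) : \sum_l (l == k)%:R * c l = c k.
  rewrite (bigD1 k) //= eqxx mul1r big1 ?addr0 // => l /negbTE ->.
  by rewrite mul0r.
have wE (c : 'I_n -> K) : \sum_k w ord0 k * c k = a j * c i - a i * c j.
  rewrite -(deltaE i c) -(deltaE j c) !mulr_sumr -sumrB; apply: eq_bigr => k _.
  by rewrite !mxE eqxx /= mulrBl !mulrA.
have /eqP : \sum_k w ord0 k * b k = 0 by apply: ab; rewrite wE mulrC subrr.
by rewrite wE subr_eq0 => /eqP.
Qed.

Section Geometry.
Local Open Scope classical_set_scope.
Variables (K : fieldType) (n : nat).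
Local Notation S := {mpoly K[n.+1]}.
Implicit Types (f g h : S) (p : proj_space K n) (v w : 'rV[K]_n.+1).

Lemma proj_point v : v != 0 -> exists p, sval p = <[v]>%VS.
Proof.
move=> v0; have dv : \dim <[v]>%VS == 1%N by rewrite dim_vline v0.
by exists (exist (fun L : {vspace 'rV[K]_n.+1} => \dim L == 1%N) _ dv).
Qed.

Lemma homogeneous_coordinates p : exists2 v, v != 0 & sval p = <[v]>%VS.
Proof.
case: p => L /= dimL; exists (vpick L).
  by rewrite vpick0 -dimv_eq0 (eqP dimL).
apply/esym/eqP; rewrite eqEdim -memvE memv_pick dim_vline (eqP dimL).
by rewrite vpick0 -dimv_eq0 (eqP dimL).
Qed.

Lemma vanishes_at_homog d h p v :
    h \is d.-homog -> v != 0 -> sval p = <[v]>%VS ->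
  vanishes_at h p <-> h.@[v ord0] = 0.
Proof.
move=> hd v0 pv; split=> [|hv w]; first by apply; rewrite // pv memv_line.
rewrite pv => /vlineP[c ->] _.
rewrite -[RHS](mulr0 (c ^+ d)) -hv -(meval_homog _ _ hd).
by apply: meval_eq => i; rewrite mxE.
Qed.

Lemma smooth_point_homog d h p v :
    h \is d.-homog -> v != 0 -> sval p = <[v]>%VS ->
  smooth_point h p <-> h.@[v ord0] = 0 /\ exists i, (h^`M(i)).@[v ord0] != 0.
Proof.
move=> hd v0 pv; have van i := vanishes_at_homog (mderiv_homog i hd) v0 pv.
split=> -[/(vanishes_at_homog hd v0 pv) hv dh]; split=> //.
  apply: contrapT => /forallNP no; apply: dh => i; apply/van.
  by apply: contrapT => /eqP/no.
by move=> no; have [k] := dh; rewrite (van k).1 ?eqxx.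
Qed.

Lemma tangent_space_homog d h p v w :
    h \is d.-homog -> v != 0 -> sval p = <[v]>%VS ->
  tangent_space h p w <-> \sum_i w ord0 i * (h^`M(i)).@[v ord0] = 0.
Proof.
move=> hd v0 pv; rewrite /tangent_space /= (@vanishes_at_homog d.-1 _ _ v) //.
  by rewrite raddf_sum /=; under eq_bigr do rewrite mevalZ.
by apply: rpred_sum => i _; apply/rpredZ/mderiv_homog.
Qed.

Definition jacobian_degenerate f g (v : 'I_n.+1 -> K) :=
  forall i j, (f^`M(i)).@[v] * (g^`M(j)).@[v] = (f^`M(j)).@[v] * (g^`M(i)).@[v].

Lemma minors2_jacobian_zero f g (v : 'I_n.+1 -> K) :
  (forall h, minors2 (jacobian f g) h -> h.@[v] = 0) <->
  jacobian_degenerate f g v.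
Proof.
have detE s : (\det (colsub s (jacobian f g))).@[v] =
    (f^`M(s ord0)).@[v] * (g^`M(s ord_max)).@[v] -
    (f^`M(s ord_max)).@[v] * (g^`M(s ord0)).@[v].
  by rewrite det_mx2 !mxE /= mevalB !mevalM.
split=> [mv|fg _ [s _ <-]]; last by rewrite detE fg subrr.
have lt_ij (i j : 'I_n.+1) : (i < j)%N ->
    (f^`M(i)).@[v] * (g^`M(j)).@[v] = (f^`M(j)).@[v] * (g^`M(i)).@[v].
  move=> ij; apply/eqP; rewrite -subr_eq0; apply/eqP.
  pose s (k : 'I_2) := if k == ord0 then i else j.
  by have := detE s; rewrite mv //; exists s.
move=> i j; case: (ltngtP i j) => [|ji|/val_inj -> //]; first exact: lt_ij.
by apply/esym/lt_ij.
Qed.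

End Geometry.

(** * The three conditions as systems of equations *)

Section Criterion.
Local Open Scope classical_set_scope.
Variables (K : fieldType) (n : nat).
Local Notation S := {mpoly K[n.+1]}.
Variables (d e : nat) (f g : S).
Hypotheses (fd : f \is d.-homog) (ge : g \is e.-homog).

Lemma jacobian_degenerate_scale v c :
  jacobian_degenerate f g v -> jacobian_degenerate f g (fun i => c * v i).
Proof.
move=> deg i j.
rewrite !(meval_homog _ _ (mderiv_homog _ fd)).
rewrite !(meval_homog _ _ (mderiv_homog _ ge)).
by rewrite mulrACA deg mulrACA.
Qed.

Lemma common_zero_algA v :
  common_zero (ideal_sum (ideal_gen [set f]) (m2 f g)) v <->
  f.@[v] = 0 /\ jacobian_degenerate f g v.
Proof.
rewrite common_zero_sum /m2 !common_zero_gen minors2_jacobian_zero.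
by split=> -[fv deg]; split=> //; [apply: fv | move=> _ ->].
Qed.

Lemma common_zero_algB v :
  common_zero
    (ideal_sum (ideal_sum (ideal_gen [set f]) (ideal_gen [set g])) (m2 f g)) v <->
  [/\ f.@[v] = 0, g.@[v] = 0 & jacobian_degenerate f g v].
Proof.
rewrite !common_zero_sum /m2 !common_zero_gen minors2_jacobian_zero.
split=> [[[fv gv] deg]|[fv gv deg]].
  by split=> //; [apply: fv | apply: gv].
by do 2?split=> //; move=> _ ->.
Qed.

(** Both ways of failing to be a smooth complete intersection make the gradients
proportional: one of them is zero,
or they have the same kernel ([orthogonal_sub_degenerate]). *)
Lemma smooth_complete_intersection_of_nondegenerate :
    (forall v, f.@[v] = 0 -> g.@[v] = 0 -> jacobian_degenerate f g v ->
      forall i, v i = 0) ->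
  smooth_complete_intersection f g.
Proof.
move=> triv p [fp gp]; have [v v0 pv] := homogeneous_coordinates p.
have fv := (vanishes_at_homog fd v0 pv).1 fp.
have gv := (vanishes_at_homog ge v0 pv).1 gp.
have ndeg : ~ jacobian_degenerate f g (v ord0).
  move=> /(triv _ fv gv) vi; case/eqP: v0; apply/rowP => i.
  by rewrite vi mxE.
split.
- apply/(smooth_point_homog fd v0 pv); split=> //.
  apply: contrapT => /forallNP no; apply: ndeg => i j.
  have f0 k : (f^`M(k)).@[v ord0] = 0 by apply: contrapT => /eqP/no.
  by rewrite !f0 !mul0r.
- apply/(smooth_point_homog ge v0 pv); split=> //.
  apply: contrapT => /forallNP no; apply: ndeg => i j.
  have g0 k : (g^`M(k)).@[v ord0] = 0 by apply: contrapT => /eqP/no.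
  by rewrite !g0 !mulr0.
move=> tfg; apply/ndeg/orthogonal_sub_degenerate => w.
move=> /(tangent_space_homog _ fd v0 pv) fw.
by apply/(tangent_space_homog _ ge v0 pv); rewrite -tfg.
Qed.

Hypothesis f_smooth : smooth_hypersurface f.
Hypothesis e_neq0 : e%:R != 0 :> K.

(** Euler's formula turns the proportionality of the gradients into [g(v) = 0],
which puts [v] on the intersection; this is where the degree of [g] has to be
invertible. *)
Lemma nondegenerate_of_smooth_complete_intersection :
    smooth_complete_intersection f g ->
  forall v, f.@[v] = 0 -> jacobian_degenerate f g v -> forall i, v i = 0.
Proof.
move=> sci v fv deg; apply: contrapT => /existsNP[i0 /eqP vi0].
pose w : 'rV[K]_n.+1 := \row_i v i.
have wE : w ord0 =1 v by move=> i; rewrite mxE.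
have w0 : w != 0.
  by apply: contra_neq vi0 => w0; rewrite -wE w0 mxE.
have [p pw] := proj_point w0.
have evE h : h.@[w ord0] = h.@[v] by apply: meval_eq.
have fp : hypersurface f p by apply/(vanishes_at_homog fd w0 pw); rewrite evE.
have [_ [k fk]] := (smooth_point_homog fd w0 pw).1 (f_smooth fp).
rewrite evE in fk.
pose c := (g^`M(k)).@[v] / (f^`M(k)).@[v].
have gc j : (g^`M(j)).@[v] = c * (f^`M(j)).@[v].
  by apply: (mulfI fk); rewrite deg /c mulrA [_ * (_ / _)]mulrC divfK // mulrC.
have gv : g.@[v] = 0.
  apply: (mulfI e_neq0); rewrite mulr0 mulr_natl -(euler_eval _ ge).
  under eq_bigr do rewrite gc mulrCA.
  by rewrite -mulr_sumr (euler_eval _ fd) fv mul0rn mulr0.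
have gp : hypersurface g p by apply/(vanishes_at_homog ge w0 pw); rewrite evE.
have [_ /(smooth_point_homog ge w0 pw)[_ [l gl]] tan] := sci p (conj fp gp).
have c0 : c != 0 by apply: contra_neq gl => c0; rewrite evE gc c0 mul0r.
apply: tan; apply/seteqP; split=> u.
  move=> /(tangent_space_homog _ fd w0 pw) fu.
  apply/(tangent_space_homog _ ge w0 pw).
  under eq_bigr do rewrite evE gc -evE mulrCA.
  by rewrite -mulr_sumr fu mulr0.
move=> /(tangent_space_homog _ ge w0 pw) gu.
apply/(tangent_space_homog _ fd w0 pw).
apply: (mulfI c0); rewrite mulr0 -[RHS]gu mulr_sumr; apply: eq_bigr => i _.
by rewrite !evE gc mulrCA.
Qed.

End Criterion.

Section Finiteness.
Local Open Scope classical_set_scope.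
Variables (K : closedFieldType) (n d e : nat) (f g : {mpoly K[n.+1]}).
Hypothesis K_uncountable : ~ countable [set: K].
Hypotheses (fd : f \is d.-homog) (ge : g \is e.-homog).

Lemma algA_finite_dimensional :
  finite_dimensional (algA f g) <->
  forall v, f.@[v] = 0 -> jacobian_degenerate f g v -> forall i, v i = 0.
Proof.
rewrite /algA finite_dimensional_cone // => [|v c /common_zero_algA[fv deg]].
  split=> H v => [fv deg|/common_zero_algA[]]; apply: H => //.
  exact/common_zero_algA.
apply/common_zero_algA; split; last exact: (jacobian_degenerate_scale fd ge).
by rewrite (meval_homog _ _ fd) fv mulr0.
Qed.

Lemma algB_finite_dimensional :
  finite_dimensional (algB f g) <->
  forall v, f.@[v] = 0 -> g.@[v] = 0 -> jacobian_degenerate f g v ->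
    forall i, v i = 0.
Proof.
rewrite /algB finite_dimensional_cone // => [|v c /common_zero_algB[fv gv deg]].
  split=> H v => [fv gv deg|/common_zero_algB[]]; apply: H => //.
  exact/common_zero_algB.
apply/common_zero_algB; split; last exact: (jacobian_degenerate_scale fd ge).
  by rewrite (meval_homog _ _ fd) fv mulr0.
by rewrite (meval_homog _ _ ge) gv mulr0.
Qed.
End Finiteness.

Unset Implicit Arguments.
Set Strict Implicit.
Set Printing Implicit Defensive.

Theorem theorem2p1 (R : realType) (n d e : nat) (f g : {mpoly R[i][n.+1]})
  (hd : (1 <= d)%N) (he : (1 <= e)%N)
  (hf : f \is d.-homog) (hg : g \is e.-homog)
  (hsm : smooth_hypersurface f) :
  (smooth_complete_intersection f g <-> finite_dimensional (algA f g)) /\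
  (finite_dimensional (algA f g) <-> finite_dimensional (algB f g)).
Proof.
have Kunc := @complex_uncountable R.
have zA := algA_finite_dimensional Kunc hf hg.
have zB := algB_finite_dimensional Kunc hf hg.
have e0 : e%:R != 0 :> R[i]%C by rewrite pnatr_eq0 -lt0n.
have sciA : smooth_complete_intersection f g -> finite_dimensional (algA f g).
  move=> sci; apply/zA.
  exact: (nondegenerate_of_smooth_complete_intersection hf hg hsm e0 sci).
have AB : finite_dimensional (algA f g) -> finite_dimensional (algB f g).
  by move=> /zA triv; apply/zB => v fv _; apply: triv.
have Bsci : finite_dimensional (algB f g) -> smooth_complete_intersection f g.
  by move=> /zB; exact: (smooth_complete_intersection_of_nondegenerate hf hg).
by split; [split=> [/sciA|/AB/Bsci] | split=> [/AB|/Bsci/sciA]].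
Qed.
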